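(* Let $G=(V,E)$ be a graph embedded in a closed orientable surface $S$ of genus $g$ so that all faces are discs, with a reference orientation. Let $h$ be a non-zero smooth circulation on $G$ and let $G'$ be the subgraph of $G$ on which $h$ does not vanish (the edges $e$ with $h_e\neq0$ together with their endpoints). Suppose that $h$ vanishes on all edges incident with a connected subgraph $U$ of $G$. Then $U$ can be separated from $G'$ by at most $16g$ nodes, i.e., there is a set $X$ of at most $16g$ nodes such that every path in $G$ from a node of $U$ to a node of $G'$ contains a node of $X$.
   Context: Each edge $e$ has tail $t(e)$, head $h(e)$, right shore $r(e)$ and left shore $l(e)$ (faces). For a node $v$, $\delta v\in\mathbb R^E$ has entries $1$ on edges with head $v$, $-1$ on edges with tail $v$, $0$ otherwise; for a face $F$, $\partial F\in\mathbb R^E$ has entries $1$ on edges with $r(e)=F$, $-1$ on edges with $l(e)=F$, $0$ otherwise. A smooth circulation is a vector $h\in\mathbb R^E$ with $h\cdot\delta v=0$ for every node $v$ and $h\cdot\partial F=0$ for every face $F$. *)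

(* Defs.v *)
From HB Require Import structures.
From mathcomp Require Import all_boot all_order all_algebra all_fingroup.
From mathcomp Require Import reals.
Set Implicit Arguments. Unset Strict Implicit. Unset Printing Implicit Defensive.
Import Order.TTheory GRing.Theory Num.Theory.

(* Combinatorial map (rotation system) model of a graph cellularly embedded
   in a closed orientable surface.
   - V : nodes, E : edges; each edge e carries the reference orientation
     from [tl e] (tail) to [hd e] (head).
   - Darts (half-edges) are pairs (e, b) : E * bool; (e,true) is the half-edge
     of e at its tail, (e,false) the half-edge at its head.
   - [sigma] is the rotation: the cyclic order of half-edges around each node.
   - Faces are the orbits of phi = sigma o alpha where alpha flips a dart. *)

Section Map.
Variables (V E : finType) (tl hd : E -> V).

Definition dflip (d : E * bool) : E * bool := (d.1, ~~ d.2).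
Lemma dflipK : involutive dflip. Proof. by case=> e b; rewrite /dflip /= negbK. Qed.
Definition alpha : {perm E * bool} := perm (can_inj dflipK).

Definition dnode (d : E * bool) : V := if d.2 then tl d.1 else hd d.1.

Definition phi (sigma : {perm E * bool}) : {perm E * bool} := (alpha * sigma)%g.

Definition faces (sigma : {perm E * bool}) : {set {set E * bool}} := porbits (phi sigma).

Definition rotation_system (sigma : {perm E * bool}) : Prop :=
  [/\ forall d, dnode (sigma d) = dnode d,
      forall d d', dnode d = dnode d' -> d' \in porbit sigma d,
      forall v : V, exists d, dnode d = v &
      forall d d', connect [rel x y | (y == sigma x) || (y == alpha x)] d d'].

Definition has_genus (sigma : {perm E * bool}) (g : nat) : Prop :=
  (#|V|%:Z - #|E|%:Z + #|faces sigma|%:Z = 2 - 2 * g%:Z)%R.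

Variable R : realType.

Definition delta (v : V) (e : E) : R :=
  ((hd e == v)%:R - (tl e == v)%:R)%R.

(* boundary of face F: +1 on edges with right shore F, -1 with left shore F.
   The right shore of e is the face containing the dart (e,true) and the left
   shore the face containing (e,false) (face orbits of sigma o alpha). *)
Definition bdry (F : {set E * bool}) (e : E) : R :=
  (((e, true) \in F)%:R - ((e, false) \in F)%:R)%R.

Definition smooth_circulation (sigma : {perm E * bool}) (h : E -> R) : Prop :=
  (forall v : V, \sum_(e : E) h e * delta v e = 0)%R /\
  (forall F, F \in faces sigma -> \sum_(e : E) h e * bdry F e = 0)%R.

End Map.

Definition adj (V E : finType) (tl hd : E -> V) : rel V :=
  fun x y => [exists e : E, ((tl e == x) && (hd e == y)) || ((tl e == y) && (hd e == x))].

Definition support_nodes (V E : finType) (tl hd : E -> V) (R : realType) (h : E -> R)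
  : {set V} := [set v | [exists e : E, (h e != 0%R) && ((tl e == v) || (hd e == v))]].

Definition connected_subgraph (V E : finType) (tl hd : E -> V)
  (UV : {set V}) (UE : {set E}) : Prop :=
  (forall e, e \in UE -> (tl e \in UV) && (hd e \in UV)) /\
  (forall u u', u \in UV -> u' \in UV ->
     connect (fun x y => [exists e in UE,
        ((tl e == x) && (hd e == y)) || ((tl e == y) && (hd e == x))]) u u').

(* Main.v *)
Require Import Defs.
From HB Require Import structures.
From mathcomp Require Import all_boot all_order all_algebra all_fingroup.
From mathcomp Require Import reals.
From mathcomp Require Import zify ring.
Import Order.TTheory GRing.Theory Num.Theory.
Set Implicit Arguments.
Unset Strict Implicit.
Unset Printing Implicit Defensive.

(* Let S be the set of nodes of G', W the component of G - S containing U, and take for X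
   the set Y of nodes of S adjacent to W. Let H consist of G', a spanning tree of W and one
   edge from each node of Y to W. Deleting an edge where h vanishes merges two faces or
   splits one, and a pendant edge takes its end node away without harming any face; so each
   deletion lowers the number of nodes plus faces along which h sums to zero by at most one,
   as long as no isolated edge is removed. Deleting all edges outside H, farthest from S and
   W first, leaves |S| + |W| nodes and at least |V| + |F| - |E \ H| - |S| - |W| such faces;
   each of them contains an edge of G'. Skipping zero
   edges, h changes sign at least twice around every node of S and along each of these
   faces. On the other hand, a corner between two edges of G' carries exactly one change,
   around its node or along its face, and the corner of a node of Y that is split by its
   edge to W carries at most two, for a total of at most 2|G'| + |Y|. Comparing with
   Euler's formula, 2(2 - 2g) + |Y| <= 2, that is |Y| <= 4g - 2. *)

(** * Orbits of permutations and transpositions *)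

Section Orbits.
Variable T : finType.
Implicit Types (s t : {perm T}) (x y z w d u v : T) (A O : {set T}).

Lemma porbit_step s x y : (s y \in porbit s x) = (y \in porbit s x).
Proof.
by rewrite -!eq_porbit_mem -(porbit_perm s 1 y) expg1.
Qed.

Lemma porbit_stable s (P : pred T) x y :
  (forall z, P z -> P (s z)) -> P x -> y \in porbit s x -> P y.
Proof.
move=> sP Px /porbitP[i ->].
by elim: i => [|i IHi]; rewrite ?expg0 ?perm1 // expgSr permM; apply: sP.
Qed.

Lemma porbit_stable_in s (P : pred T) x y : P x ->
  (forall z, z \in porbit s x -> P z -> P (s z)) -> y \in porbit s x -> P y.
Proof.
move=> Px sP yx.
suff /andP[] : (y \in porbit s x) && P y by [].
apply: (@porbit_stable s (fun z => (z \in porbit s x) && P z)) yx.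
  by move=> z /andP[zx Pz]; rewrite porbit_step zx sP.
by rewrite porbit_id.
Qed.

Lemma porbit_trans s x y z :
  x \in porbit s y -> y \in porbit s z -> x \in porbit s z.
Proof. by rewrite -!eq_porbit_mem => /eqP-> /eqP->. Qed.

Lemma porbits_mem s O x : O \in porbits s -> x \in O -> O = porbit s x.
Proof. by case/imsetP=> y _ -> xy; apply/eqP; rewrite eq_sym eq_porbit_mem. Qed.

Lemma porbit_fix s x : s x = x -> porbit s x = [set x].
Proof.
move=> sx; apply/setP=> y; rewrite inE; apply/idP/eqP => [|->]; last exact: porbit_id.
by move=> yx; apply/eqP; apply: (porbit_stable (P := pred1 x)) yx => //= z /eqP->; rewrite sx.
Qed.

Lemma porbit_two s x y : s x = y -> s y = x -> porbit s x = [set x; y].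
Proof.
move=> sx sy; apply/setP=> z; rewrite !inE; apply/idP/orP => [zx|[]/eqP->].
- apply/orP; apply: (porbit_stable (P := fun w => (w == x) || (w == y))) zx => [w /orP[]/eqP->|];
    rewrite ?eqxx //.
    by rewrite sx eqxx orbT.
  by rewrite sy eqxx.
- exact: porbit_id.
- by rewrite -sx porbit_step porbit_id.
Qed.

Lemma eq_porbit_in s t x :
  (forall z, z \in porbit s x -> t z = s z) -> porbit t x = porbit s x.
Proof.
move=> st; apply/setP=> z; apply/idP/idP.
  apply: (@porbit_stable_in _ (fun v => v \in porbit s x)) => [|{}z _ zx]; first exact: porbit_id.
  by rewrite st // porbit_step.
apply: (@porbit_stable_in _ (fun v => v \in porbit t x)) => [|{}z zx zt]; first exact: porbit_id.
by rewrite -st // porbit_step.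
Qed.

(** The transposition only exchanges the images of [x] and [y], so each of the two cycles, on coming
    back to its base point, runs over into the other. *)
Lemma porbit_tperm_merge s x y w : x \notin porbit s y ->
  porbit (tperm x y * s)%g w =
    if (w \in porbit s x) || (w \in porbit s y) then porbit s x :|: porbit s y
    else porbit s w.
Proof.
set t := (_ * s)%g => nxy.
have tE z : z != x -> z != y -> t z = s z.
  by move=> zx zy; rewrite permM tpermD // eq_sym.
have tx : t x = s y by rewrite permM tpermL.
have ty : t y = s x by rewrite permM tpermR.
have xP z : z \in porbit s x -> z \in porbit t x.
  rewrite -(porbitV s); apply: (@porbit_stable_in _ (fun v => v \in porbit t x)) => [|{}z zx IH].
    exact: porbit_id.
  rewrite -porbit_step; set z' := (s^-1)%g z.
  case: (eqVneq z' x) => [->|nx]; first by rewrite porbit_step porbit_id.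
  rewrite tE ?permKV //; apply: contraNneq nxy => <-.
  by rewrite porbit_sym -porbit_step permKV -porbitV.
have yP z : z \in porbit s y -> z \in porbit t y.
  rewrite -(porbitV s); apply: (@porbit_stable_in _ (fun v => v \in porbit t y)) => [|{}z zy IH].
    exact: porbit_id.
  rewrite -porbit_step; set z' := (s^-1)%g z.
  case: (eqVneq z' y) => [->|ny]; first by rewrite porbit_step porbit_id.
  rewrite tE ?permKV //; apply: contraNneq nxy => <-.
  by rewrite -porbit_step permKV -porbitV.
have xy : x \in porbit t y.
  rewrite porbit_sym; apply: (@porbit_trans _ _ (t x)); last by rewrite porbit_step porbit_id.
  by rewrite porbit_sym tx; apply: yP; rewrite porbit_step porbit_id.
case: ifP => [wU|/norP[wx wy]].
  have wx : w \in porbit t x.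
    by case/orP: wU => [/xP //|/yP wy]; apply: porbit_trans wy _; rewrite porbit_sym.
  have -> : porbit t w = porbit t x by apply/eqP; rewrite eq_porbit_mem.
  apply/setP=> z; rewrite inE; apply/idP/orP => [|[/xP //|/yP zy]].
    move=> zx; apply/orP.
    apply: (@porbit_stable t (fun z => (z \in porbit s x) || (z \in porbit s y))) zx.
      move=> {}z; case: (eqVneq z x) => [-> _|zx]; first by rewrite tx !porbit_step porbit_id orbT.
      case: (eqVneq z y) => [-> _|zy]; first by rewrite ty !porbit_step porbit_id.
      by rewrite tE // !porbit_step.
    by rewrite porbit_id.
  by apply: porbit_trans zy _; rewrite porbit_sym.
have st z : z \in porbit s w -> t z = s z.
  move=> zw; rewrite tE //.
    by apply: contraNneq wx => <-; rewrite porbit_sym.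
  by apply: contraNneq wy => <-; rewrite porbit_sym.
exact: eq_porbit_in.
Qed.

(** Splices [d] out of its cycle: [d] becomes a fixed point and its predecessor is sent to [s d]. *)
Definition skip s d : {perm T} := (tperm d ((s^-1)%g d) * s)%g.

Lemma skip_fix s d : skip s d d = d.
Proof. by rewrite permM tpermL permKV. Qed.

Lemma skip_id s d u : u != d -> s u != d -> skip s d u = s u.
Proof.
move=> ud sud; rewrite permM tpermD // 1?eq_sym //.
by apply: contraNneq sud => ->; rewrite permKV.
Qed.

Lemma skip_fixed s d : s d = d -> skip s d = s.
Proof. by move=> sd; rewrite /skip -{2}sd permK tperm1 mul1g. Qed.

Lemma skip_merge s d : s d != d ->
  d \notin porbit (skip s d) ((s^-1)%g d) /\
  s = (tperm d ((s^-1)%g d) * skip s d)%g.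
Proof.
move=> sd; split; last by rewrite /skip mulgA tperm2 mul1g.
rewrite porbit_sym porbit_fix ?skip_fix // inE.
by apply: contra sd => /eqP pd; rewrite -{1}pd permKV.
Qed.

Lemma porbit_skip s d u v : u != d -> v != d ->
  (v \in porbit (skip s d) u) = (v \in porbit s u).
Proof.
move=> ud vd; case: (eqVneq (s d) d) => [/skip_fixed-> //|sd].
have [nd {2}->] := skip_merge sd; rewrite (porbit_tperm_merge u nd).
rewrite (porbit_fix (skip_fix s d)) inE (negPf ud) /=.
case: ifP => // up; rewrite !inE (negPf vd) /=.
by congr (v \in pred_of_set _); apply/eqP; rewrite eq_porbit_mem.
Qed.

(** [s0] is the first-return map of [s] to the complement of [Z], completed by the identity on
    [Z]. *)
Lemma skip_all s (Z : seq T) : exists s0 : {perm T},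
  [/\ forall z, z \in Z -> s0 z = z,
      forall u v, u \notin Z -> v \notin Z -> (v \in porbit s0 u) = (v \in porbit s u)
    & forall u, u \notin Z -> s u \notin Z -> s0 u = s u].
Proof.
elim: Z s => [|d Z IHZ] s; first by exists s.
have [s0 [fixZ orbZ stepZ]] := IHZ (skip s d); exists s0; split.
- move=> z; rewrite inE; case: (boolP (z \in Z)) => [zZ _|zZ]; first exact: fixZ.
  by rewrite orbF => /eqP zd; rewrite stepZ ?zd ?skip_fix // -zd.
- move=> u v; rewrite !inE !negb_or => /andP[ud uZ] /andP[vd vZ].
  by rewrite orbZ // porbit_skip.
- move=> u; rewrite !inE !negb_or => /andP[ud uZ] /andP[vd vZ].
  by rewrite stepZ ?skip_id.
Qed.

End Orbits.

(** * Zero-sum orbits under transpositions *)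

Section GoodOrbits.
Variables (T : finType) (R : realDomainType) (h : T -> R).
Implicit Types (s t : {perm T}) (x y z w d u v : T) (A O : {set T}).
Local Open Scope ring_scope.

Definition zero_sum (A : {set T}) : bool := \sum_(x in A) h x == 0.

Definition good_orbits (s : {perm T}) : {set {set T}} :=
  [set O in porbits s | zero_sum O].

Lemma zero_sum_merge s x y : x \notin porbit s y -> zero_sum (porbit s x) ->
  zero_sum (porbit s x :|: porbit s y) = zero_sum (porbit s y).
Proof.
move=> nxy gx.
rewrite {1}/zero_sum (big_setID (porbit s x)) /= setUK setDUl setDv set0U.
rewrite (eqP gx) add0r (setDidPl _) // -setI_eq0; apply/set0Pn => -[z].
rewrite inE => /andP[zy zx]; case/negP: nxy.
by apply: porbit_trans zy; rewrite porbit_sym.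
Qed.

Lemma card_good_merge s x y : x \notin porbit s y ->
  (#|good_orbits s| + zero_sum (porbit s x :|: porbit s y) =
   #|good_orbits (tperm x y * s)%g| + zero_sum (porbit s x) + zero_sum (porbit s y))%N.
Proof.
move=> nxy; set t := (_ * s)%g; set X := porbit s x; set Y := porbit s y.
have nXY : X != Y by rewrite eq_porbit_mem.
pose rest := good_orbits s :\ X :\ Y.
have Xs : X \in porbits s by apply: imset_f.
have Ys : Y \in porbits s by apply: imset_f.
have -> : #|good_orbits s| = (zero_sum X + zero_sum Y + #|rest|)%N.
  rewrite (cardsD1 X) (cardsD1 Y (_ :\ _)) addnA !inE Xs Ys /=.
  by rewrite eq_sym nXY.
have -> : #|good_orbits t| = (zero_sum (X :|: Y) + #|rest|)%N.
  rewrite (cardsD1 (X :|: Y)).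
  have tE w : porbit t w = if (w \in X) || (w \in Y) then X :|: Y else porbit s w.
    exact: porbit_tperm_merge.
  have Ut : X :|: Y \in porbits t.
    by apply/imsetP; exists x => //; rewrite tE porbit_id.
  rewrite inE Ut /=; congr (_ + #|pred_of_set _|)%N; apply/setP=> O; rewrite !inE.
  case: (boolP (zero_sum O)) => [_|_]; last by rewrite !andbF.
  rewrite !andbT; apply/andP/and3P => [[OU /imsetP[w _ Ow]]|[OY OX /imsetP[w _ Ow]]].
    rewrite tE in Ow; case: ifP Ow OU => [_ ->|/norP[wX wY] -> _]; first by rewrite eqxx.
    by rewrite !eq_porbit_mem; split => //; apply: imset_f.
  rewrite {}Ow in OY OX *; rewrite !eq_porbit_mem in OY OX.
  split; last by apply/imsetP; exists w => //; rewrite tE (negPf OX) (negPf OY).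
  apply: contraNneq OX => wU; have : x \in X :|: Y by rewrite inE porbit_id.
  by rewrite -wU porbit_sym.
lia.
Qed.

(** A merge turns two orbits into one, which is good if both parts were; a split destroys a single
    orbit. *)
Lemma card_good_tperm s x y : x != y ->
  (#|good_orbits s| <= #|good_orbits (tperm x y * s)%g| + 1)%N.
Proof.
move=> xy; case: (boolP (x \in porbit s y)) => [oxy|nxy]; last first.
  have := card_good_merge nxy.
  have : zero_sum (porbit s x) -> zero_sum (porbit s x :|: porbit s y) = zero_sum (porbit s y).
    exact: zero_sum_merge.
  case: (zero_sum (porbit s x)) => [/(_ isT)->|_].
    by case: (zero_sum (porbit s y)) => /=; lia.
  case: (zero_sum (porbit s x :|: porbit s y)); by case: (zero_sum (porbit s y)) => /=; lia.
rewrite (cardsD1 (porbit s y)) addnC leq_add ?leq_b1 //.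
apply: subset_leq_card; apply/subsetP=> O; rewrite !inE => /and3P[OY /imsetP[w _ Ow] gO].
rewrite {}Ow in OY gO *; rewrite gO andbT; rewrite eq_porbit_mem in OY.
apply/imsetP; exists w => //.
have st z : z \in porbit s w -> (tperm x y * s)%g z = s z.
  move=> zw; rewrite permM tpermD //; apply: contraNneq OY => zE.
    by apply: porbit_trans oxy; rewrite zE porbit_sym.
  by rewrite zE porbit_sym.
by rewrite (eq_porbit_in st).
Qed.

Lemma card_good_tperm_merge s x y : x \notin porbit s y -> zero_sum (porbit s x) ->
  #|good_orbits s| = (#|good_orbits (tperm x y * s)%g| + 1)%N.
Proof.
move=> nxy gx; have := card_good_merge nxy; rewrite gx.
by rewrite (zero_sum_merge nxy gx); case: (zero_sum (porbit s y)) => /=; lia.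
Qed.

Lemma card_good_skip s d : h d = 0 -> s d != d ->
  #|good_orbits (skip s d)| = (#|good_orbits s| + 1)%N.
Proof.
move=> hd sd; have [nd sE] := skip_merge sd.
rewrite {2}sE; apply: card_good_tperm_merge nd _.
by rewrite porbit_fix ?skip_fix // /zero_sum big_set1 hd.
Qed.

(* Deleting an edge with zero value merges two faces or splits one; the two
   trivial node orbits and the trivial face orbit it leaves behind count as good. *)
Lemma card_good_delete (a s : {perm T}) x :
  involutive a -> a x != x -> h x = 0 -> h (a x) = 0 ->
  s x != x -> s x != a x ->
  (#|good_orbits s| + #|good_orbits (a * s)%g| + 2 <=
   #|good_orbits (skip (skip s (a x)) x)| +
   #|good_orbits (a * skip (skip s (a x)) x)%g|)%N.
Proof.
move=> aK ax hx hax sx sax; set d := a x.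
have tpermE (r : {perm T}) u v : (a * (tperm u v * r) = tperm (a u) (a v) * (a * r))%g.
  apply/permP=> z; rewrite !permM; congr (r _).
  by rewrite inj_tperm ?aK //; apply: can_inj aK.
set s1 := skip s d.
(* Unless [d] is already fixed, splicing it out adds a good fixed point to [s] and multiplies
   [a * s] by one transposition, which costs at most one good orbit. *)
have step1 : (#|good_orbits s| + #|good_orbits (a * s)%g| <=
              #|good_orbits s1| + #|good_orbits (a * s1)%g|)%N.
  case: (eqVneq (s d) d) => [sd|sd]; first by rewrite /s1 skip_fixed.
  rewrite /s1 (card_good_skip hax sd) /skip tpermE.
  have := @card_good_tperm (a * s)%g (a d) (a ((s^-1)%g d)).
  rewrite (inj_eq (can_inj aK)).
  have -> : d != (s^-1)%g d by apply: contra sd => /eqP pd; rewrite {1}pd permKV.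
  by move=> /(_ isT); lia.
have s1x : s1 x = s x by rewrite /s1 skip_id // eq_sym.
have s1d : s1 d = d by apply: skip_fix.
have s1x' : s1 x != x by rewrite s1x.
have [nx s1E] := skip_merge s1x'.
set s2 := skip s1 x in nx s1E *; set p := (s1^-1)%g x in nx s1E.
have pd : p != d.
  by apply: contra ax => /eqP pd; rewrite -/d -{1}s1d -pd permKV.
have px : p != x by apply: contra s1x' => /eqP pE; rewrite -{1}pE permKV.
have s2x : s2 x = x by apply: skip_fix.
have s2d : s2 d = d by rewrite /s2 skip_id ?s1d.
have -> : #|good_orbits s2| = (#|good_orbits s1| + 1)%N by apply: card_good_skip.
(* The second dart brings a gain on both sides: a fixed point of the rotation, and the face orbit
   formed by the two darts of the deleted edge. *)
have orbd : porbit (a * s2)%g d = [set d; x].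
  by apply: porbit_two; rewrite permM ?/d ?aK -/d ?s2x ?s2d.
have -> : #|good_orbits (a * s2)%g| = (#|good_orbits (a * s1)%g| + 1)%N.
  rewrite {1}s1E tpermE; apply: card_good_tperm_merge; rewrite -/d.
    rewrite porbit_sym orbd !inE negb_or /d (inj_eq (can_inj aK)) px /=.
    by apply: contra pd => /eqP apx; rewrite /d -apx aK.
  by rewrite orbd /zero_sum big_setU1 ?inE // big_set1 hx hax /= addr0.
by lia.
Qed.

(** A zero sum with a nonzero term has terms of both signs. If [s0] never stepped from a positive to
    a negative value, positivity would spread to every nonzero point of the orbit. *)
Lemma zero_sum_descent s s0 (O : {set T}) q :
  O \in porbits s -> zero_sum O -> q \in O -> h q != 0 ->
  (forall z, h z = 0 -> s0 z = z) ->
  (forall u v, h u != 0 -> h v != 0 -> (v \in porbit s0 u) = (v \in porbit s u)) ->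
  exists2 p, p \in O & (h p > 0) && (h (s0 p) < 0).
Proof.
move=> Os /eqP sum0 qO hq fix0 orb0.
have [[x xO hx] [y yO hy]] : (exists2 x, x \in O & h x > 0) /\ (exists2 y, y \in O & h y < 0).
  split; apply/exists_inP; apply: contraT; rewrite negb_exists_in => /forall_inP nO.
    have /eqP := sum0; rewrite -oppr_eq0 -sumrN psumr_eq0 => [/allP/(_ q)|x xO].
      by rewrite mem_index_enum qO /= oppr_eq0 (negPf hq) => /(_ isT).
    by rewrite oppr_ge0 leNgt nO.
  have /eqP := sum0; rewrite psumr_eq0 => [/allP/(_ q)|x xO].
    by rewrite mem_index_enum qO /= (negPf hq) => /(_ isT).
  by rewrite leNgt nO.
have nz s1 z : (forall z, h z = 0 -> s1 z = z) -> h z != 0 -> h (s1 z) != 0.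
  by move=> f1; apply: contra => /eqP hz; have /perm_inj <- := f1 _ hz; rewrite hz.
apply/exists_inP; apply: contraT; rewrite negb_exists_in => /forall_inP nO.
have yx : y \in porbit s0 x.
  by rewrite orb0 -?(porbits_mem Os xO) // ?(gt_eqF hx) ?(lt_eqF hy).
have : 0 < h y; last by rewrite ltNge ltW.
apply: (porbit_stable_in (P := fun z => 0 < h z)) yx => // z zx hz.
have zO : z \in O by rewrite (porbits_mem Os xO) -orb0 // ?(gt_eqF hx) ?(gt_eqF hz).
have := nO z zO; rewrite hz /= -leNgt le_eqVlt eq_sym.
by rewrite (negPf (nz s0 z fix0 _)) // gt_eqF.
Qed.

Definition nonzero_good_orbits s := [set O in good_orbits s | [exists q in O, h q != 0]].

End GoodOrbits.

(** * Sign changes along zero-sum orbits *)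

Section SignChanges.
Variables (T : finType) (R : realDomainType) (h : T -> R).
Local Open Scope ring_scope.

(** Each orbit has a descent and, by the same argument for the negated values, an ascent; no point
    is both. *)
Lemma sign_changes (s : {perm T}) : exists s0 : {perm T},
  (forall u, h u != 0 -> h (s u) != 0 -> s0 u = s u) /\
  (2 * #|nonzero_good_orbits h s| <=
   #|[set p | (h p != 0) && ((0 < h p) != (0 < h (s0 p)))]%R|)%N.
Proof.
have [s0 [fix0 orb0 step0]] := skip_all s (enum [pred z | h z == 0]).
have memZ z : (z \in enum [pred z | h z == 0]) = (h z == 0) by rewrite mem_enum inE.
exists s0; split=> [u hu hsu|]; first by rewrite step0 // memZ.
have fixE z : h z = 0 -> s0 z = z by move/eqP=> hz; rewrite fix0 ?memZ.
have orbE u v : h u != 0 -> h v != 0 -> (v \in porbit s0 u) = (v \in porbit s u).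
  by move=> hu hv; rewrite orb0 ?memZ.
pose desc := [set p | (0 < h p) && (h (s0 p) < 0)].
pose asc := [set p | (h p < 0) && (0 < h (s0 p))].
have cover (A : {set T}) : (forall O, O \in nonzero_good_orbits h s -> exists2 p, p \in O & p \in A) ->
    (#|nonzero_good_orbits h s| <= #|A|)%N.
  move=> hA; apply: leq_trans (leq_imset_card (porbit s) A).
  apply: subset_leq_card; apply/subsetP=> O Og; have [p pO pA] := hA O Og.
  apply/imsetP; exists p => //; apply: porbits_mem => //.
  by move: Og; rewrite !inE => /andP[/andP[]].
have leD : (#|nonzero_good_orbits h s| <= #|desc|)%N.
  apply: cover => O; rewrite !inE => /andP[/andP[Os Oz] /exists_inP[q qO hq]].
  have [p pO hp] := zero_sum_descent Os Oz qO hq fixE orbE.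
  by exists p; rewrite ?inE.
have leA : (#|nonzero_good_orbits h s| <= #|asc|)%N.
  apply: cover => O; rewrite !inE => /andP[/andP[Os Oz] /exists_inP[q qO hq]].
  have [] := @zero_sum_descent _ _ (fun z => - h z) s s0 O q Os _ qO.
  - by rewrite /zero_sum sumrN oppr_eq0.
  - by rewrite oppr_eq0.
  - by move=> z /eqP; rewrite oppr_eq0 => /eqP/fixE.
  - by move=> v w; rewrite !oppr_eq0; apply: orbE.
  by move=> p pO; rewrite oppr_gt0 oppr_lt0 => hp; exists p; rewrite ?inE.
have dDA : desc :&: asc = set0.
  by apply/setP=> p; rewrite !inE; case: (ltgtP (h p) 0); rewrite ?andbF.
rewrite mul2n -addnn; apply: leq_trans (leq_add leD leA) _.
rewrite -cardsUI dDA cards0 addn0; apply: subset_leq_card; apply/subsetP=> p.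
rewrite !inE => /orP[]/andP[hp hsp].
  by rewrite gt_eqF // hp ltNge (ltW hsp).
by rewrite lt_eqF // hsp ltNge (ltW hp).
Qed.

End SignChanges.

(** * Spanning trees *)

Section Connectivity.
Variables (V E : finType) (tl hd : E -> V).

(** [rk] is the distance to [B] along [r]: the first step of a shortest path lowers it. *)
Lemma rank_to_set (r : rel V) (B : {set V}) :
  exists rk : V -> nat, forall v b, connect r v b -> b \in B ->
    v \in B \/ exists2 w, r v w & (rk w < rk v)%N.
Proof.
pose P v n := [exists p : n.-tuple V, path r v p && (last v p \in B)].
pose reach v := [exists b in B, connect r v b].
have reachP v : reach v -> exists n, P v n.
  case/exists_inP=> b bB /connectP[p rp bE]; exists (size p).
  by apply/existsP; exists (in_tuple p); rewrite rp -bE.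
pose Q v n := reach v -> P v n /\ forall m, P v m -> (n <= m)%N.
have [rk rkP] : exists rk : V -> nat, forall v, Q v (rk v).
  apply: (fin_all_exists (P := Q)) => v; rewrite /Q.
  have [/reachP exn|_] := boolP (reach v); last by exists 0%N.
  by exists (ex_minn exn) => _; case: ex_minnP.
exists rk => v b vb bB.
have [|/existsP[p /andP[rp lp]] _] := rkP v; first by apply/exists_inP; exists b.
case: (rk v) p rp lp => [|n] p; first by rewrite tuple0 /=; left.
case/tupleP: p => w p /= /andP[vw rp] lp; right; exists w => //.
have Pw : P w n by apply/existsP; exists p; rewrite rp.
have [|_ /(_ _ Pw)] // := rkP w.
by apply/exists_inP; exists (last w p) => //; apply/connectP; exists p.
Qed.

Definition joins (A : {set E}) : rel V := fun x y => [exists e in A,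
  ((tl e == x) && (hd e == y)) || ((tl e == y) && (hd e == x))].

Lemma joins_sym A : symmetric (joins A).
Proof. by move=> x y; apply/exists_inP/exists_inP=> -[e eA]; rewrite orbC; exists e. Qed.

Lemma joins_tl_hd (A : {set E}) e : e \in A -> joins A (tl e) (hd e).
Proof. by move=> eA; apply/exists_inP; exists e; rewrite ?eqxx. Qed.

(** Every node of [W] other than [u] is the farther end of the first edge on a shortest path to
    [u]. *)
Lemma card_connecting_edges (A : {set E}) (W : {set V}) u :
  (forall w, w \in W -> connect (joins A) u w) -> (#|W| <= #|A| + 1)%N.
Proof.
move=> conW; have [rk rkP] := rank_to_set (joins A) [set u].
pose top e := if (rk (hd e) < rk (tl e))%N then tl e else hd e.
rewrite (cardsD1 u) addnC leq_add ?leq_b1 //.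
apply: leq_trans (leq_imset_card top A); apply: subset_leq_card; apply/subsetP=> w.
rewrite !inE => /andP[wu wW].
have [] := rkP w u; rewrite ?inE ?(negPf wu) //.
  by rewrite (sym_connect_sym (joins_sym A)) conW.
case=> // v /exists_inP[e eA /orP[]/andP[/eqP te /eqP he]] vw;
  apply/imsetP; exists e => //; rewrite /top te he ?vw //.
by rewrite ltnNge ltnW.
Qed.

(* A connecting edge set of minimal size is a tree, and every tree edge is a bridge,
   witnessed by the cut [f]. *)
Lemma tree_exists (A : {set E}) (W : {set V}) u :
  (forall w, w \in W -> connect (joins A) u w) ->
  exists B : {set E}, [/\ B \subset A, forall w, w \in W -> connect (joins B) u w &
    forall e, e \in B -> exists2 f : pred V, f (tl e) != f (hd e) &
      forall e', e' \in B -> e' != e -> f (tl e') = f (hd e')].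
Proof.
pose P (B : {set E}) := [forall w in W, connect (joins B) u w].
move=> conA; have /minset_exists[B /minsetP[/forall_inP conB minB] sBA] : P A.
  by apply/forall_inP.
(* The cut is the side of [u] once [e] is removed. With both ends of [e] on one side, [e] could be
   dropped, against minimality. *)
exists B; split=> // e eB; pose f := connect (joins (B :\ e)) u.
have fE e' : e' \in B -> e' != e -> f (tl e') = f (hd e').
  move=> e'B e'e; apply: same_connect_r; first exact/sym_connect_sym/joins_sym.
  by apply: connect1; apply: joins_tl_hd; rewrite !inE e'e.
exists f => //; apply/negP => /eqP fe.
have PB : P (B :\ e).
  apply/forall_inP=> w /conB uw.
  have stepf x y : joins B x y -> f x -> f y.
    case/exists_inP=> e' e'B H; have fe' : f (tl e') = f (hd e').
      by case: (eqVneq e' e) => [->|]; [|exact: fE].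
    by case/orP: H => /andP[/eqP<- /eqP<-]; rewrite fe'.
  have stepp p : forall x, path (joins B) x p -> f x -> f (last x p).
    by elim: p => //= y p IHp x /andP[xy yp] fx; apply: IHp yp _; apply: stepf xy fx.
  case/connectP: uw => p up ->; apply: stepp up _; exact: connect0.
by have /setP/(_ e) := minB _ PB (subD1set B e); rewrite !inE eqxx eB.
Qed.

End Connectivity.

(** * Deleting edges of an embedded graph *)

Section Deletion.
Variables (V E : finType) (tl hd : E -> V) (R : realDomainType) (h : E -> R).
Local Notation dart := (E * bool)%type.
Local Notation node := (dnode tl hd).
Implicit Types (s : {perm dart}) (A H : {set E}) (d x : dart).
Local Open Scope ring_scope.

(** With this sign the sum over the darts at a node is the net outflow of [h], and the sum over a
    face is the pairing of [h] with [bdry]. *)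
Definition dart_value (d : dart) : R := if d.2 then h d.1 else - h d.1.
Local Notation hD := dart_value.
Local Notation good := (good_orbits hD).

Lemma alphaE d : alpha E d = (d.1, ~~ d.2).
Proof. by rewrite permE. Qed.

Lemma alphaK : involutive (alpha E).
Proof. by case=> e b; rewrite !alphaE /= negbK. Qed.

Lemma dart_value_alpha d : hD (alpha E d) = - hD d.
Proof. by rewrite alphaE /dart_value /=; case: d.2; rewrite /= ?opprK. Qed.

Lemma dart_value_eq0 d : (hD d == 0) = (h d.1 == 0).
Proof. by rewrite /dart_value; case: d.2; rewrite ?oppr_eq0. Qed.

Lemma same_edge d x : d.1 = x.1 -> d = x \/ d = alpha E x.
Proof.
by rewrite alphaE; case: d x => [e []] [e' []] /= ->; [left|right|right|left].
Qed.

Lemma skip_step s d x :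
  skip s d x = if x == d then d else if s x == d then s d else s x.
Proof.
case: (eqVneq x d) => [->|xd]; first exact: skip_fix.
case: (eqVneq (s x) d) => [sx|sx]; last exact: skip_id.
by rewrite /skip permM -{2}sx permK tpermR.
Qed.

Variable sigma : {perm dart}.

(* [s] is what remains of [sigma] when the edges outside [A] are deleted; their
   darts stay behind as fixed points. *)
Definition deleted_map A s : Prop :=
  [/\ forall d, d.1 \notin A -> s d = d,
      forall d, node (s d) = node d,
      forall d d', d.1 \in A -> d'.1 \in A -> node d = node d' -> d' \in porbit s d
    & (#|good sigma| + #|good (alpha E * sigma)%g| + 2 * #|~: A| <=
       #|good s| + #|good (alpha E * s)%g|)%N].

Lemma delete_edge A s e d : deleted_map A s -> e \in A -> h e = 0 ->
  d.1 \in A -> d.1 != e -> (node d = tl e \/ node d = hd e) ->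
  exists s', deleted_map (A :\ e) s'.
Proof.
case=> fixA nodeA orbA goodA eA he dA de nd.
have [x0 x0e x0d] : exists2 x0, x0.1 = e & node x0 = node d.
  by case: nd => ->; [exists (e, true)|exists (e, false)].
(* The dart [d] witnesses that [e] is not isolated: if darts of [e] were followed only by darts of
   [e], the orbit of [x0] would miss [d]. *)
have [x [xe sx sax]] : exists x, [/\ x.1 = e, s x != x & s x != alpha E x].
  have [/existsP[x /and3P[/eqP xe sx sax]]|] :=
    boolP [exists x, [&& x.1 == e, s x != x & s x != alpha E x]].
    by exists x.
  rewrite negb_exists => /forallP nx.
  have dx : d \in porbit s x0 by apply: orbA; rewrite ?x0e.
  case/negP: de; apply: (porbit_stable (P := fun z : dart => z.1 == e)) dx; last by rewrite x0e.
  move=> z /eqP ze; have := nx z; rewrite ze eqxx /= negb_and !negbK.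
  by case/orP=> /eqP->; rewrite ?alphaE ze.
have axe : (alpha E x).1 = e by rewrite alphaE.
have ax : alpha E x != x by rewrite alphaE; case: (x) => f []; rewrite xpair_eqE andbC.
pose s1 := skip s (alpha E x); exists (skip s1 x); split.
- move=> z; rewrite !inE negb_and negbK => zA.
  case: (eqVneq z.1 e) => [ze|ze].
    have [->|->] : z = x \/ z = alpha E x by apply: same_edge; rewrite ze.
      exact: skip_fix.
    by rewrite skip_id ?skip_fix.
  have {}zA : z.1 \notin A by rewrite (negPf ze) in zA.
  have nz y : y.1 = e -> z != y by move=> ye; apply: contraNneq ze => ->; rewrite ye.
  have s1z : s1 z = z by rewrite /s1 skip_id ?fixA ?nz.
  by rewrite skip_id ?s1z ?nz.
- have nodeS (r : {perm dart}) y z : (forall u, node (r u) = node u) -> node (skip r y z) = node z.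
    move=> nr; rewrite skip_step; case: eqP => [->//|_].
    by case: eqP => [rz|_]; rewrite ?nr // -rz nr.
  by move=> z; apply: (nodeS _ _ _ (fun u => nodeS _ _ _ nodeA)).
- move=> u v; rewrite !inE => /andP[ue uA] /andP[ve vA] uv.
  have nz y z : y.1 != e -> z.1 = e -> y != z by move=> ye ze; apply: contraNneq ye => ->; rewrite ze.
  by rewrite !porbit_skip ?nz // orbA.
have hx z : z.1 = e -> hD z = 0 by move=> ze; apply/eqP; rewrite dart_value_eq0 ze he.
apply: leq_trans (card_good_delete alphaK ax (hx _ xe) (hx _ axe) sx sax).
have -> : #|~: (A :\ e)| = (#|~: A| + 1)%N.
  by rewrite setCD setUC cardsU1 !inE eA /= addnC.
by rewrite mulnDr muln1 addnA leq_add2r.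
Qed.

(** Edges go by decreasing [key], the rank of the nearer end. That end has a dart of [H], or an edge
    to a node of lower rank, whose [key] is smaller and which is therefore still present; so the
    deleted edge is never isolated. *)
Lemma delete_edges H (rk : V -> nat) :
  deleted_map setT sigma -> (forall e, e \notin H -> h e = 0) ->
  (forall v, (exists2 d, d.1 \in H & node d = v) \/
             exists2 w, joins tl hd setT v w & (rk w < rk v)%N) ->
  exists s, deleted_map H s.
Proof.
move=> del0 hH rkP; pose key e := minn (rk (tl e)) (rk (hd e)).
have : exists A s, [/\ deleted_map A s, H \subset A &
    forall e e', e \in A :\: H -> e' \notin A -> (key e <= key e')%N].
  by exists setT, sigma; split=> // e e' _; rewrite inE.
case=> A; move: {2}#|_| (erefl #|A :\: H|) => n.
elim: n A => [|n IHn] A cardA [s [delA HA keyA]].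
  exists s; suff -> : H = A by [].
  by apply/eqP; rewrite eqEsubset HA -setD_eq0 -cards_eq0 cardA.
have /set0Pn[e0 e0A] : A :\: H != set0 by rewrite -cards_eq0 cardA.
pose e := [arg max_(e > e0 in A :\: H) key e].
have [eAH emax] : e \in A :\: H /\ forall e', e' \in A :\: H -> (key e' <= key e)%N.
  by rewrite /e; case: arg_maxnP.
have /setDP[eA eH] := eAH.
have [v ve vkey] : exists2 v, v = tl e \/ v = hd e & rk v = key e.
  rewrite /key; case: (leqP (rk (tl e)) (rk (hd e))) => rke.
    by exists (tl e) => //; left.
  by exists (hd e) => //; right.
have [d [dA de dv]] : exists d, [/\ d.1 \in A, d.1 != e & node d = v].
  have [[d dH dv]|[w /exists_inP[e' _ e'j] wv]] := rkP v.
    exists d; split=> //; first exact: (subsetP HA).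
    by apply: contraNneq eH => <-.
  have key' : (key e' < key e)%N.
    by rewrite -vkey /key; case/orP: e'j => /andP[/eqP-> /eqP->]; rewrite gtn_min wv ?orbT.
  have e'A : e' \in A by apply: contraLR key' => e'A; rewrite -leqNgt keyA.
  have e'e : e' != e by apply: contraTneq key' => ->; rewrite ltnn.
  by case/orP: e'j => /andP[/eqP t /eqP t']; [exists (e', true)|exists (e', false)].
have dve : node d = tl e \/ node d = hd e by rewrite dv.
have [s' delA'] := delete_edge delA eA (hH _ eH) dA de dve.
apply: (IHn (A :\ e)).
  by move: cardA; rewrite (cardsD1 e) eAH setDDl setUC -setDDl => -[].
exists s'; split=> // [|f f'].
  by rewrite subsetD1 HA.
rewrite !inE => /and3P[fH fe fA]; rewrite negb_and negbK => /orP[/eqP->|].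
  by apply: emax; rewrite inE fH.
by apply: keyA; rewrite inE fH.
Qed.

End Deletion.

(** * Counting sign changes *)

Section Counting.
Variables (V E : finType) (tl hd : E -> V) (R : realDomainType) (h : E -> R).
Local Notation dart := (E * bool)%type.
Local Notation node := (dnode tl hd).
Local Notation hD := (dart_value h).
Local Notation good := (good_orbits hD).
Local Notation al := (alpha E).
Local Open Scope ring_scope.

Variables (sigma s : {perm dart}) (S W Y : {set V}) (T : {set E}) (st : V -> E) (u : V).
(** [T] is the spanning tree of [W], and [st y] is the edge chosen from [y] to [W]. *)
Let H : {set E} := [set e | h e != 0] :|: st @: Y :|: T.
Hypothesis nzS : forall d, hD d != 0 -> node d \in S.
Hypothesis Snz : forall v, v \in S -> exists2 d, hD d != 0 & node d = v.
Hypothesis SW : forall v, v \in S -> v \notin W.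
Hypothesis TW : forall d, d.1 \in T -> node d \in W.
Hypothesis YS : Y \subset S.
Hypothesis stP : forall y, y \in Y -> exists d,
  [/\ d.1 = st y, node d = y & node (al d) \in W].
Hypothesis conT : forall w, w \in W -> connect (joins tl hd T) u w.
Hypothesis bridgeT : forall e, e \in T -> exists2 f : pred V, f (tl e) != f (hd e) &
      forall e', e' \in T -> e' != e -> f (tl e') = f (hd e').
Hypothesis mapH : deleted_map tl hd h sigma H s.
Let phiH := (al * s)%g.

Lemma s_dead d : d.1 \notin H -> s d = d. Proof. by case: mapH => + _ _ _; apply. Qed.
Lemma s_node d : node (s d) = node d. Proof. by case: mapH. Qed.
Lemma s_orbit d d' : d.1 \in H -> d'.1 \in H -> node d = node d' -> d' \in porbit s d.
Proof. by case: mapH => _ _ + _; apply. Qed.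

Lemma s_live d : ((s d).1 \in H) = (d.1 \in H).
Proof.
apply/idP/idP => [sd|dH]; apply: contraTT isT => nd.
  by move: sd; rewrite s_dead ?(negPf nd).
by have /perm_inj sd := s_dead nd; move: nd; rewrite sd dH.
Qed.

Lemma nz_live d : hD d != 0 -> d.1 \in H.
Proof. by rewrite dart_value_eq0 => hd0; rewrite !inE hd0. Qed.

Lemma live_node d : d.1 \in H -> node d \in S :|: W.
Proof.
rewrite !inE -dart_value_eq0 => /orP[/orP[/nzS-> //|]|/TW->]; last by rewrite orbT.
case/imsetP=> y yY dy; have [d0 [d0y d0n d0W]] := stP yY.
have [->|->] : d = d0 \/ d = al d0 by apply: same_edge; rewrite dy d0y.
  by rewrite d0n (subsetP YS).
by rewrite d0W orbT.
Qed.

(** Tree edges have both ends in [W] and an edge [st y] has its other end there, so a node of [S]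
    carries at most one zero dart of [H]. *)
Lemma zero_dart_star d : d.1 \in H -> hD d = 0 -> node d \in S ->
  node d \in Y /\ d.1 = st (node d).
Proof.
rewrite !inE -dart_value_eq0 => dH d0 dS; move: dH; rewrite d0 eqxx /=.
case/orP=> [/imsetP[y yY dy]|/TW]; last by rewrite (negPf (SW dS)).
have [d1 [d1y d1n d1W]] := stP yY.
have [->|dE] : d = d1 \/ d = al d1 by apply: same_edge; rewrite dy d1y.
  by rewrite d1n d1y.
by case/negP: (SW dS); rewrite dE.
Qed.

Lemma zero_dart_inj d d' : d.1 \in H -> d'.1 \in H -> hD d = 0 -> hD d' = 0 ->
  node d \in S -> node d = node d' -> d = d'.
Proof.
move=> dH dH' d0 d0' dS dd'.
have [dY dE] := zero_dart_star dH d0 dS.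
have [_ dE'] : node d' \in Y /\ d'.1 = st (node d').
  by apply: zero_dart_star; rewrite -?dd'.
have [d1 [d1E d1n d1W]] := stP dY.
have uni z : node z \in S -> z.1 = d1.1 -> z = d1.
  by move=> zS /same_edge[//|zE]; case/negP: (SW zS); rewrite zE.
have -> : d = d1 by apply: uni; rewrite ?dE ?d1E.
by apply/esym/uni; rewrite -?dd' // dE' -dd' d1E.
Qed.

(** Otherwise [d], the only zero dart of [H] at its node, would be fixed by [s] and alone in its
    orbit, although every node of [S] has a nonzero dart. *)
Lemma zero_dart_next d : d.1 \in H -> hD d = 0 -> node d \in S -> hD (s d) != 0.
Proof.
move=> dH d0 dS; apply/negP => /eqP sd0.
have sd : s d = d by apply: zero_dart_inj; rewrite ?s_live ?s_node.
have [q q0 qd] := Snz dS.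
have : q \in porbit s d by apply: s_orbit; rewrite ?(nz_live q0).
by rewrite porbit_fix // inE => /eqP qE; rewrite qE d0 eqxx in q0.
Qed.

Lemma zero_dart_prev d : d.1 \in H -> hD d = 0 -> node d \in S -> hD ((s^-1)%g d) != 0.
Proof.
set d' := (s^-1)%g d => dH d0 dS; have sd' : s d' = d by rewrite permKV.
apply/negP => /eqP d'0.
suff : hD (s d') != 0 by rewrite sd' d0 eqxx.
by apply: zero_dart_next; rewrite // -1?s_live -1?s_node ?sd'.
Qed.

Lemma phiHE d : phiH d = s (al d). Proof. by rewrite permM. Qed.

Lemma phiH_live d : ((phiH d).1 \in H) = (d.1 \in H).
Proof. by rewrite phiHE s_live alphaE. Qed.

(* A face walk using only tree edges traverses every tree edge as often in one
   direction as in the other, so it is closed under [al] and [s] and fills a component. *)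
Lemma face_has_nonzero d : Y != set0 -> d.1 \in H ->
  exists2 q, q \in porbit phiH d & hD q != 0.
Proof.
move=> /set0Pn[y0 y0Y] dH; apply/exists_inP; apply: contraT; rewrite negb_exists_in.
move=> /forall_inP zero; set O := porbit phiH d in zero.
have {}zero z : z \in O -> hD z = 0 by move/zero; rewrite negbK => /eqP.
have liveO z : z \in O -> z.1 \in H.
  by apply: (porbit_stable (P := fun z : dart => z.1 \in H)) => // w; rewrite phiH_live.
have stepO z : (phiH z \in O) = (z \in O) by apply: porbit_step.
(* At a node of [S] the rotation neighbours of a zero dart are nonzero, and a face walk through that
   dart uses one of them, possibly reversed. So a walk of zeros avoids [S]. *)
have nS z : z \in O -> node z \notin S.
  move=> zO; apply/negP => zS.
  case/negP: (zero_dart_prev (liveO _ zO) (zero _ zO) zS).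
  by rewrite -oppr_eq0 -dart_value_alpha zero // -stepO phiHE alphaK permKV.
have nSa z : z \in O -> node (al z) \notin S.
  move=> zO; apply/negP => zS; have zH : (al z).1 \in H by rewrite alphaE /= liveO.
  have hz : hD (al z) = 0 by rewrite dart_value_alpha zero ?oppr0.
  by case/negP: (zero_dart_next zH hz zS); rewrite -phiHE zero ?stepO.
have OT z : z \in O -> z.1 \in T.
  move=> zO; have := liveO z zO; rewrite !inE -dart_value_eq0 (zero z zO) eqxx /=.
  case/orP=> // /imsetP[y yY zy]; have [d0 [d0E d0y _]] := stP yY.
  have yS := subsetP YS y yY.
  have [dE|dE] : d0 = z \/ d0 = al z by apply: same_edge; rewrite zy d0E.
    by case/negP: (nS _ zO); rewrite -dE d0y.
  by case/negP: (nSa _ zO); rewrite -dE d0y.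
have alO z : z \in O -> al z \in O.
  move=> zO; apply: contraT => azO.
  have [f fz fT] := bridgeT (OT z zO).
  (* Around the closed walk, [f] has the same sum over the starts as over the ends of darts. Only
     the edge of [z] crosses the cut, so a single traversal would make the sums differ. *)
  have : (\sum_(x in O) f (node x) = \sum_(x in O) f (node (al x)))%N.
    rewrite (reindex_inj (@perm_inj _ phiH)) /=.
    by apply: eq_big => x; rewrite ?stepO // phiHE s_node.
  rewrite (bigD1 z) // [RHS](bigD1 z) //=.
  rewrite [in RHS](eq_bigr (fun x => nat_of_bool (f (node x)))); last first.
    move=> x /andP[xO xz]; have := fT _ (OT x xO); rewrite alphaE /dnode /=.
    have -> : x.1 != z.1.
      apply: contraNneq azO => /same_edge[xE|<- //]; by rewrite xE eqxx in xz.
    by move/(_ isT); case: x.2 => /= ->.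
  move/eqP; rewrite eqn_add2r alphaE /dnode /=.
  by move: fz; case: z.2 => /=; do 2!case: (f _).
have sO z : z \in O -> s z \in O.
  by move=> /alO zO; rewrite -[z]alphaK -phiHE stepO.
have full z x : z \in O -> x.1 \in H -> node x = node z -> x \in O.
  move=> zO xH xz; have : x \in porbit s z by apply: s_orbit; rewrite ?(liveO _ zO).
  exact: (porbit_stable (P := fun z => z \in O)).
have dO : d \in O by apply: porbit_id.
have [d0 [d0E d0y d0W]] := stP y0Y.
have d0H : (al d0).1 \in H.
  by rewrite alphaE /= !inE d0E imset_f ?orbT.
pose P v := [exists z in O, node z == v].
have stepP v w : joins tl hd T v w -> P v -> P w.
  case/exists_inP=> e eT ej /exists_inP[z zO /eqP zv].
  have eH : e \in H by rewrite !inE eT orbT.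
  case/orP: ej => /andP[/eqP te /eqP he].
    have eO : (e, true) \in O by apply: (full z); rewrite ?zv // /dnode /= te.
    by apply/exists_inP; exists (al (e, true)); rewrite ?alO // alphaE /dnode /= he.
  have eO : (e, false) \in O by apply: (full z); rewrite ?zv // /dnode /= he.
  by apply/exists_inP; exists (al (e, false)); rewrite ?alO // alphaE /dnode /= te.
have pathP p : forall v, path (joins tl hd T) v p -> P v -> P (last v p).
  by elim: p => //= w p IHp v /andP[vw wp] Pv; apply: IHp wp _; apply: stepP vw Pv.
have conP v w : connect (joins tl hd T) v w -> P v -> P w.
  by case/connectP=> p vp -> Pv; apply: pathP.
(* The walk fills the component, so it reaches the end in [W] of a chosen edge and contains its dart
   there, whose reverse sits at [y0] in [S]. *)
have Pd0 : P (node (al d0)).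
  apply: (conP u); first exact: conT.
  apply: (conP (node d)); last by apply/exists_inP; exists d.
  rewrite (sym_connect_sym (joins_sym _ _ T)); apply/conT/TW/OT => //.
case/exists_inP: Pd0 => z zO /eqP zd0.
have /nSa : al d0 \in O by apply: (full z).
by rewrite alphaK d0y (subsetP YS).
Qed.

(** A deleted edge leaves two fixed darts, a node of [W] has at most one orbit of darts of [H], and
    such an orbit at a node of [S] has a nonzero dart. *)
Lemma card_good_node : (#|good s| <= 2 * #|~: H| + #|W| + #|nonzero_good_orbits hD s|)%N.
Proof.
pose fw w := if [pick d | (d.1 \in H) && (node d == w)] is Some d then porbit s d else set0.
have cardD : #|[set d : dart | d.1 \in ~: H]| = (2 * #|~: H|)%N.
  rewrite mulnC -card_bool -(cardsT bool) -cardsX.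
  by congr #|pred_of_set _|; apply/setP=> d; rewrite !inE andbT.
rewrite -cardD; apply: leq_trans (leq_add (leq_add (leq_imset_card (porbit s) _)
  (leq_imset_card fw _)) (leqnn _)).
apply: leq_trans (leq_add (leq_of_leqif (leq_card_setU _ _)) (leqnn _)).
apply: leq_trans (leq_of_leqif (leq_card_setU _ _)).
apply: subset_leq_card; apply/subsetP=> O Og; have := Og.
rewrite inE => /andP[/imsetP[d _ Od] _]; rewrite 2!in_setU -orbA.
have [dH|dH] := boolP (d.1 \in H); last first.
  by apply/orP; left; apply/imsetP; exists d; rewrite // inE in_setC.
apply/orP; right; have := live_node dH; rewrite inE => /orP[dS|dW]; apply/orP.
  right; rewrite inE Og /=.
  have [q q0 qd] := Snz dS; apply/exists_inP; exists q => //.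
  by rewrite Od; apply: s_orbit; rewrite ?(nz_live q0).
left; apply/imsetP; exists (node d) => //; rewrite /fw; case: pickP => [d'|/(_ d)].
  case/andP=> d'H /eqP d'd; rewrite Od; apply/eqP.
  by rewrite eq_porbit_mem s_orbit.
by rewrite dH eqxx.
Qed.

(** The two darts of a deleted edge form one face orbit; all other orbits fall under
    [face_has_nonzero]. *)
Lemma card_good_face : Y != set0 ->
  (#|good phiH| <= #|~: H| + #|nonzero_good_orbits hD phiH|)%N.
Proof.
move=> Y0; apply: leq_trans (leq_add (leq_imset_card (fun e => porbit phiH (e, true)) _) (leqnn _)).
apply: leq_trans (leq_of_leqif (leq_card_setU _ _)).
apply: subset_leq_card; apply/subsetP=> O Og; have := Og.
rewrite inE => /andP[/imsetP[d _ Od] _].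
have [dH|dH] := boolP (d.1 \in H).
  have [q qd q0] := face_has_nonzero Y0 dH.
  rewrite in_setU; apply/orP; right; rewrite inE Og /=.
  by apply/exists_inP; exists q; rewrite // Od.
rewrite inE; apply/orP; left; apply/imsetP; exists d.1; first by rewrite in_setC.
rewrite Od; apply/eqP; rewrite eq_porbit_mem; case: (d) dH => e [] /= eH; first exact: porbit_id.
have <- : phiH (e, true) = (e, false) by rewrite phiHE alphaE s_dead.
by rewrite porbit_step porbit_id.
Qed.

(* When the dart following [p] in the rotation is nonzero, it also follows [al p] in the
   face walk, and [al p] has the sign opposite to [p]: only one of the two sign changes
   occurs. A zero dart follows [p] at most once for each node of [Y]. *)
Lemma card_sign_changes :
  (2 * #|nonzero_good_orbits hD s| + 2 * #|nonzero_good_orbits hD phiH| <=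
   2 * #|[set e | h e != 0]%R| + #|Y|)%N.
Proof.
have [s0 [s0E le_s]] := sign_changes hD s.
have [f0 [f0E le_f]] := sign_changes hD phiH.
apply: leq_trans (leq_add le_s le_f) _; set C := [set p | _] ; set C' := [set p | _].
pose NZ := [set d | hD d != 0].
have <- : #|NZ| = (2 * #|[set e | h e != 0]%R|)%N.
  rewrite mulnC -card_bool -(cardsT bool) -cardsX.
  by congr #|pred_of_set _|; apply/setP=> d; rewrite !inE andbT dart_value_eq0.
(* Reversal moves each face change to the corner where the node change is recorded, so the
   intersection counts the corners carrying both. *)
have -> : #|C'| = #|al @: C'| by rewrite card_imset //; apply: (can_inj (@alphaK E)).
rewrite -cardsUI.
apply: leq_add.
  apply: subset_leq_card; apply/subsetP=> p; rewrite !inE => /orP[/andP[] //|].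
  case/imsetP=> q; rewrite inE => /andP[q0 _] ->.
  by rewrite dart_value_alpha oppr_eq0.
pose K := [set p | (hD p != 0) && (hD (s p) == 0)].
apply: (@leq_trans #|K|).
  apply: subset_leq_card; apply/subsetP=> p; rewrite !inE => /andP[/andP[p0 sgp]].
  case/imsetP=> q; rewrite inE => /andP[q0 sgq] pq; rewrite p0 /=.
  apply: contraT => sp0; move: sgp sgq.
  have fq : phiH q = s p by rewrite phiHE pq.
  rewrite s0E // f0E ?fq // pq dart_value_alpha oppr_gt0.
  by case: (ltgtP (hD q) 0) q0 => // _ _; case: (0 < _).
have KH p : p \in K -> [/\ (s p).1 \in H, hD (s p) = 0 & node (s p) \in S].
  by rewrite inE => /andP[p0 /eqP sp0]; rewrite s_live nz_live // s_node nzS.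
rewrite -(@card_in_imset _ _ (fun p => node (s p)) (mem K)); last first.
  move=> p q /KH[pH p0 pS] /KH[qH q0 qS] pq.
  exact: (@perm_inj _ s) (zero_dart_inj pH qH p0 q0 pS pq).
apply: subset_leq_card; apply/subsetP=> _ /imsetP[p /KH[pH p0 pS] ->].
by have [] := zero_dart_star pH p0 pS.
Qed.

(** The three kinds of edges have none, one and two ends in [W], and [st] is injective because the
    other end of [st y] is [y]. *)
Lemma card_kept_edges : (#|[set e | h e != 0]%R| + #|Y| + #|T| <= #|H|)%N.
Proof.
have hW d : hD d != 0 -> node d \notin W by move/nzS/SW.
have stS y : y \in Y -> y \notin W by move=> yY; apply/SW/(subsetP YS).
have stI : {in Y &, injective st}.
  move=> y y' yY y'Y yy'; have [d [dE dn dW]] := stP yY; have [d' [dE' dn' dW']] := stP y'Y.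
  have [dd|dd] : d' = d \/ d' = al d by apply: same_edge; rewrite dE dE' yy'.
    by rewrite -dn -dd dn'.
  by have := stS _ y'Y; rewrite -dn' dd dW.
rewrite /H [X in (_ <= X)%N]cardsU [#|_ :|: _|]cardsU card_in_imset //.
have -> : [set e | h e != 0] :&: st @: Y = set0.
  apply/setP=> e; rewrite !inE; apply/negP => /andP[e0 /imsetP[y yY ey]].
  have [d [dE dn dW]] := stP yY; apply/negP: dW; apply: hW.
  by rewrite dart_value_eq0 alphaE /= dE -ey.
have -> : ([set e | h e != 0] :|: st @: Y) :&: T = set0.
  apply/setP=> e; rewrite !inE; apply/negP => /andP[/orP[e0|/imsetP[y yY ey]] eT].
    have := TW (d := (e, true)) eT; apply/negP; apply: hW.
    by rewrite dart_value_eq0.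
  have [d [dE dn dW]] := stP yY; case/negP: (stS _ yY); rewrite -dn.
  by apply: TW; rewrite dE -ey.
by rewrite cards0 !subn0.
Qed.

(** A deleted edge leaves three trivial orbits, of which [deleted_map] already counts two; the net
    loss is one per deleted edge. The nonzero orbits are bounded by sign changes, and [#|W|] by
    [#|T| + 1]. *)
Lemma star_bound : u \in W -> Y != set0 ->
  (2 * (#|good sigma| + #|good (al * sigma)%g|) + #|Y| <= 2 * #|E| + 2)%N.
Proof.
move=> uW Y0; have [_ _ _ le0] := mapH.
have := card_good_node; have := card_good_face Y0; have := card_sign_changes.
have := card_kept_edges; have := card_connecting_edges conT.
have : (#|H| + #|~: H|)%N = #|E| by rewrite cardsC.
move: le0; rewrite -/phiH.
move: #|good sigma| #|good (al * sigma)%g| #|good s| #|good phiH| #|~: H| #|H| #|W| #|T| #|Y| #|E|.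
move: #|nonzero_good_orbits hD s| #|nonzero_good_orbits hD phiH| #|[set e | h e != 0]%R|.
lia.
Qed.

End Counting.

(** * The separating set and Euler's formula *)

Lemma sum_darts (E : finType) (R : realDomainType) (F : E * bool -> R) :
  (\sum_d F d = \sum_e (F (e, true) + F (e, false)))%R.
Proof.
rewrite (eq_bigr (fun d => F (d.1, d.2))); last by case.
rewrite -(pair_bigA _ (fun e b => F (e, b))) /=.
by apply: eq_bigr => e _; rewrite big_bool.
Qed.

Theorem mainTheorem6 (V E : finType) (tl hd : E -> V) (sigma : {perm E * bool})
  (g : nat) (R : realType) (h : E -> R) (UV : {set V}) (UE : {set E}) :
  rotation_system tl hd sigma ->
  has_genus V sigma g ->
  smooth_circulation tl hd sigma h ->
  (exists e, h e != 0%R) ->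
  connected_subgraph tl hd UV UE ->
  (forall e, (tl e \in UV) || (hd e \in UV) -> h e = 0%R) ->
  exists X : {set V}, (#|X| <= 16 * g)%N /\
    forall (u : V) (p : seq V), u \in UV -> path (adj tl hd) u p ->
      last u p \in support_nodes tl hd h -> exists2 x, x \in u :: p & x \in X.
Proof.
move=> [rot_node rot_orbit rot_surj rot_conn] genus [node_law face_law] [e0 he0] [UE_sub U_conn] U_zero.
have [->|/set0Pn[u uU]] := eqVneq UV set0.
  by exists set0; split=> [|u p]; rewrite ?cards0 ?inE.
set S := support_nodes tl hd h; set node := dnode tl hd; set hD := dart_value h.
(* [r] never enters [S], and [u] lies outside [S], so [W] is the component of [u] in the graph
   without [S]. *)
pose r := [rel x y | adj tl hd x y && (y \notin S)].
pose W := [set w | connect r u w].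
have US v : v \in UV -> v \notin S.
  move=> vU; rewrite inE; apply/existsP => -[e /andP[he ve]]; case/negP: he.
  by apply/eqP/U_zero; case/orP: ve => /eqP->; rewrite vU ?orbT.
have uW : u \in W by rewrite inE.
have W_step w x : w \in W -> adj tl hd w x -> x \notin S -> x \in W.
  move=> + wx xS; rewrite [w \in W]inE [x \in W]inE => uw.
  apply: connect_trans uw (connect1 _).
  by rewrite /= wx.
have WS w : w \in W -> w \notin S.
  rewrite inE => /connectP[p up ->]; case/lastP: p up => [_|p x]; first exact: US.
  by rewrite rcons_path last_rcons => /and3P[].
have UW v : v \in UV -> v \in W.
  move=> vU; have /connectP[p up ->] := U_conn u v uU vU.
  have : u \in UV := uU; move: up uW; elim: p (u) => //= x p IHp w /andP[wx xp] wW wU.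
  case/exists_inP: wx => e eUE ewx; have /andP[tU hU] := UE_sub e eUE.
  have xU : x \in UV by move: tU hU; case/orP: ewx => /andP[/eqP-> /eqP->].
  apply: IHp => //; apply: W_step wW _ (US _ xU).
  by apply/existsP; exists e.
pose Y := [set y in S | [exists w in W, adj tl hd w y]].
exists Y; split; last first.
  (* The path stays in [W] until it first enters [S], so the node of entry lies in [Y]. *)
  move=> v p /UW; elim: p v => [|x p IHp] v vW /=; first by rewrite (negPf (WS _ vW)).
  case/andP=> vx xp lS; have [xS|xS] := boolP (x \in S).
    exists x; first by rewrite !inE eqxx orbT.
    by rewrite inE xS; apply/exists_inP; exists v.
  have [y yp yY] := IHp x (W_step _ _ vW vx xS) xp lS.
  by exists y; rewrite // inE yp orbT.
have [->|Y0] := eqVneq Y set0; first by rewrite cards0.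
have nzS d : hD d != 0%R -> node d \in S.
  rewrite dart_value_eq0 inE => hd0; apply/existsP; exists d.1.
  by rewrite hd0 /node /dnode; case: d.2; rewrite eqxx ?orbT.
have Snz v : v \in S -> exists2 d, hD d != 0%R & node d = v.
  rewrite inE => /existsP[e /andP[he /orP[]/eqP ev]].
    by exists (e, true); rewrite ?dart_value_eq0.
  by exists (e, false); rewrite ?dart_value_eq0.
have SW v : v \in S -> v \notin W by apply: contraL => /WS.
pose A := [set e | (tl e \in W) && (hd e \in W)].
have conA w : w \in W -> connect (joins tl hd A) u w.
  rewrite inE => /connectP[p up ->]; elim/last_ind: p up => [|p x IHp].
    by rewrite connect0.
  rewrite rcons_path last_rcons => /andP[up /andP[px xS]].
  apply: connect_trans (IHp up) (connect1 _).
  have pW : last u p \in W by rewrite inE; apply/connectP; exists p.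
  have xW := W_step _ _ pW px xS; case/existsP: px => e ej.
  apply/exists_inP; exists e => //.
  by rewrite inE; case/orP: ej => /andP[/eqP-> /eqP->]; rewrite pW xW.
have [T [TA conT bridgeT]] := tree_exists conA.
have TW d : d.1 \in T -> node d \in W.
  by move/(subsetP TA); rewrite inE /node /dnode => /andP[tW hW]; case: d.2.
have YS : Y \subset S by apply/subsetP=> y; rewrite inE => /andP[].
(* The default [e0] is never returned for [y] in [Y], which has an edge to [W]. *)
pose st y := odflt e0 [pick e |
  ((tl e == y) && (hd e \in W)) || ((hd e == y) && (tl e \in W))].
have stP y : y \in Y -> exists d, [/\ d.1 = st y, node d = y & node (alpha E d) \in W].
  rewrite inE => /andP[yS /exists_inP[w wW /existsP[e ewy]]]; rewrite /st.
  case: pickP => [f /orP[]/andP[/eqP fy fW]|/(_ e)] /=.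
  - by exists (f, true); rewrite alphaE.
  - by exists (f, false); rewrite alphaE.
  by case/orP: ewy => /andP[/eqP-> /eqP->]; rewrite eqxx wW ?orbT.
set H := [set e | h e != 0%R] :|: st @: Y :|: T.
have conV v : connect (joins tl hd setT) v u.
  have [[d dv] [d' d'u]] := (rot_surj v, rot_surj u).
  have /connectP[p dp d'E] := rot_conn d d'; rewrite -dv -d'u d'E.
  elim: p (d) dp {d'E dv} => [|x p IHp] z /=; first by rewrite connect0.
  case/andP=> zx /IHp; apply: connect_trans.
  case/orP: zx => /eqP->; first by rewrite rot_node connect0.
  apply: connect1; apply/exists_inP; exists z.1; first by rewrite inE.
  by rewrite alphaE /dnode /=; case: z.2; rewrite /= !eqxx ?orbT.
have [rk rkP] := rank_to_set (joins tl hd setT) (S :|: W).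
have [s mapH] : exists s, deleted_map tl hd h sigma H s.
  apply: (@delete_edges _ _ _ _ _ _ _ _ rk).
  - split=> [d|d|d d' _ _|]; rewrite ?inE //; first exact: rot_orbit.
    by rewrite setCT cards0 muln0 addn0.
  - by move=> e; rewrite !inE !negb_or negbK => /andP[/andP[/eqP]].
  move=> v; have [] := rkP v u (conV v); [by rewrite inE uW orbT| |by right].
  rewrite inE => /orP[/Snz[d hd0 dv]|vW]; left.
    by exists d; rewrite // !inE -dart_value_eq0 hd0.
  (* [W] may be a single node without tree edges; a chosen edge, available since [Y] is nonempty,
     then ends there. *)
  have /set0Pn[y yY] := Y0; have [d [dy _ dW]] := stP y yY.
  have : connect (joins tl hd T) v (node (alpha E d)).
    apply: (connect_trans (y := u)); last exact: conT.
    by rewrite (sym_connect_sym (joins_sym _ _ T)) conT.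
  case/connectP=> -[_ /= dv|x p /= /andP[vx _] _].
    by exists (alpha E d); rewrite // alphaE /= !inE dy imset_f ?orbT.
  case/exists_inP: vx => e eT /orP[]/andP[/eqP te /eqP he].
    by exists (e, true); rewrite // !inE eT orbT.
  by exists (e, false); rewrite // !inE eT orbT.
have bound := star_bound nzS Snz SW TW YS stP conT bridgeT mapH uW Y0.
have sumV v : (\sum_(d | node d == v) hD d = 0)%R.
  rewrite -[RHS]oppr0 -[X in _ = (- X)%R](node_law v) -sumrN big_mkcond sum_darts.
  apply: eq_bigr => e _; rewrite /delta /node /dnode /hD /dart_value /=.
  by case: eqP; case: eqP => _ _ /=; ring.
have leV : (#|V| <= #|good_orbits hD sigma|)%N.
  pose f (O : {set E * bool}) := if [pick d in O] is Some d then node d else u.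
  rewrite -cardsT; apply: leq_trans (leq_imset_card f _).
  apply: subset_leq_card; apply/subsetP=> v _; have [d dv] := rot_surj v.
  have orbE d' : (d' \in porbit sigma d) = (node d' == v).
    apply/idP/eqP => [|d'v]; last by apply: rot_orbit; rewrite dv.
    move=> d'd; apply/eqP; apply: (porbit_stable (P := fun z => node z == v)) d'd.
      by move=> z /eqP <-; rewrite /node rot_node.
    by apply/eqP.
  apply/imsetP; exists (porbit sigma d).
    rewrite inE imset_f //= /zero_sum; apply/eqP; rewrite -[RHS](sumV v).
    by apply: eq_bigl => d'; rewrite orbE.
  rewrite /f; case: pickP => [d'|/(_ d)]; last by rewrite porbit_id.
  by rewrite orbE => /eqP.
have leF : (#|faces sigma| <= #|good_orbits hD (alpha E * sigma)%g|)%N.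
  apply: subset_leq_card; apply/subsetP=> F FF; rewrite inE FF /=.
  apply/eqP; rewrite -[RHS](face_law F FF) big_mkcond sum_darts.
  apply: eq_bigr => e _; rewrite /bdry /hD /dart_value /=.
  by do 2!case: (_ \in F) => /=; ring.
(* By Euler's formula there are at least [#|E| + 2 - 2 * g] good orbits, so [bound] yields
   [#|Y| <= 4 * g - 2], which is below [16 * g]. *)
move: genus bound leV leF; rewrite /has_genus /hD.
move: #|good_orbits hD sigma| #|good_orbits hD _| #|faces sigma| #|Y| #|E| #|V|.
lia.
Qed.
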